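(* Let $H=(V,S)$ be a signed hypergraph, let $s\in S$, and let $e\subseteq V$ be such that $s\subset e$ (strict containment of the underlying edge of $s$ in $e$). Let $H'=(V,S')$ be obtained from $H$ by inflating $s$ to $e$. Then an extended formulation of $\mathcal P_{pB}(H)$ can be obtained by juxtaposing an (arbitrary) extended formulation of $\mathcal P_{pB}(H')$ and the equality constraint $$z_s=\sum_{s'\in I(s,e)} z_{s'}.$$ Moreover, if $\mathcal P_{pB}(H')$ has a polynomial-size extended formulation and $|e|-|s|=O(\log \mathrm{poly}(|V|,|S|))$, then $\mathcal P_{pB}(H)$ has a polynomial-size extended formulation as well.
   Context: A signed hypergraph $H$ is a pair $(V,S)$ with $V$ a finite set of nodes and $S$ a set of signed edges. A signed edge is a pair $s=(e,\eta_s)$ with $e\subseteq V$, $|e|\ge 2$, and $\eta_s:e\to\{-1,+1\}$; $e$ is its underlying edge. No two signed edges of $S$ are identical (same $e$ and same $\eta_s$), but signed edges may be parallel (same $e$). Set-theoretic notation for $s$ refers to its underlying edge. Inflation: for $s\in S$ and $e\subseteq V$ with $s\subset e$, let $I(s,e)$ be the set of all possible signed edges $s'$ with underlying edge $e$ such that $\eta_{s'}(v)=\eta_s(v)$ for every $v\in s$. $H'=(V,S')$ is obtained from $H$ by inflating $s$ to $e$ if $S'=(S\cup I(s,e))\setminus\{s\}$. For a signed edge $s$ and $v\in s$, let $\sigma_s(z_v):=z_v$ if $\eta_s(v)=+1$ and $\sigma_s(z_v):=1-z_v$ if $\eta_s(v)=-1$. The pseudo-Boolean set is $\mathcal S_{pB}(H):=\{z\in\{0,1\}^{V\cup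 S}: z_s=\prod_{v\in s}\sigma_s(z_v)\ \forall s\in S\}$, and the pseudo-Boolean polytope $\mathcal P_{pB}(H)$ is its convex hull. An extended formulation of $\mathcal P_{pB}(H)$ is a finite system of linear inequalities and equalities, in the variables $z$ indexed by $V\cup S$ together with additional variables, whose solution set projects (orthogonally) onto $\mathcal P_{pB}(H)$ in the $z$-space. In the juxtaposition, $z_s$ is a new variable not occurring in the extended formulation of $\mathcal P_{pB}(H')$, and the variables $z_{s'}$, $s'\in I(s,e)$, are those of $\mathcal P_{pB}(H')$; variables not indexed by $V\cup S$ are treated as additional variables. An extended formulation is polynomial-size if its number of variables and constraints is bounded by a polynomial in the numbers of nodes and signed edges. $\mathrm{poly}(|V|,|S|)$ denotes a polynomial function of $|V|,|S|$; the asymptotic statement is understood over a family of instances with a fixed polynomial and fixed $O$-constant, the resulting polynomial size bound being uniform over the family. *)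

(* Defs.v *)
From HB Require Import structures.
From mathcomp Require Import all_boot all_order all_algebra.
From mathcomp Require Import classical_sets reals exp.
Set Implicit Arguments.
Unset Strict Implicit.
Unset Printing Implicit Defensive.

Import Order.TTheory GRing.Theory Num.Theory.
Local Open Scope classical_set_scope.
Local Open Scope ring_scope.

(* A pair (e, eta) with eta : e -> {-1, +1} is encoded as the partial function
   V -> option bool with domain e: [Some true] is +1, [Some false] is -1 and
   [None] means "not in e".  Equality is equality of both e and eta. *)
Definition dom (V : finType) (f : {ffun V -> option bool}) : {set V} :=
  [set v | f v != None]%SET.

Record sedge (V : finType) : Type := SEdge {
  sgn :> {ffun V -> option bool};
  _ : (2 <= #|dom sgn|)%N }.

HB.instance Definition _ (V : finType) := [isSub for @sgn V].
HB.instance Definition _ (V : finType) := [Finite of sedge V by <:].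

(* The node set is the whole finite type V. *)
Definition shypergraph (V : finType) : Type := {set sedge V}.

Definition inflations (V : finType) (s : sedge V) (e : {set V}) :
    {set sedge V} :=
  [set s' : sedge V | (dom s' == e) && [forall v in dom s, s' v == s v]]%SET.

Definition inflate (V : finType) (H : shypergraph V) (s : sedge V)
    (e : {set V}) : shypergraph V :=
  ((H :|: inflations s e) :\ s)%SET.

(* The index set "V union S" of the z-space. *)
Definition coord (V : finType) (H : shypergraph V) : finType :=
  (V + {s : sedge V | s \in H})%type.

(* Only used for v in the underlying edge of s; the value at [None] is junk. *)
Definition sigma (R : realType) (V : finType) (s : sedge V) (v : V) (x : R) :
    R :=
  if s v == Some false then 1 - x else x.

Definition pb_set (R : realType) (V : finType) (H : shypergraph V) :
    set {ffun coord H -> R} :=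
  [set z | (forall i, z i = 0 \/ z i = 1) /\
           forall s : {s : sedge V | s \in H},
             z (inr s) = \prod_(v in dom (val s)) sigma (val s) v (z (inl v))].

Definition convex_hull (R : realType) (I : finType) (X : set {ffun I -> R}) :
    set {ffun I -> R} :=
  [set x | exists (n : nat) (p : 'I_n -> {ffun I -> R}) (l : 'I_n -> R),
     [/\ forall k, X (p k), forall k, 0 <= l k, \sum_k l k = 1
       & x = [ffun i => \sum_k l k * p k i]]].

Definition pb_polytope (R : realType) (V : finType) (H : shypergraph V) :
    set {ffun coord H -> R} :=
  convex_hull (@pb_set R V H).

(* Variable names: z_v for nodes, z_s for signed edges, and anonymous names
   drawn from the finite type A. *)
Definition var (V A : finType) : finType := (V + sedge V + A)%type.
Definition zn (V A : finType) (v : V) : var V A := inl (inl v).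
Definition ze (V A : finType) (s : sedge V) : var V A := inl (inr s).

Inductive lincon (R : realType) (U : finType) : Type :=
| LinLe of {ffun U -> R} & R
| LinEq of {ffun U -> R} & R.

Definition coef (R : realType) (U : finType) (c : lincon R U) :
    {ffun U -> R} :=
  match c with LinLe a _ => a | LinEq a _ => a end.

Definition supp (R : realType) (U : finType) (c : lincon R U) : {set U} :=
  [set u | coef c u != 0]%SET.

Definition sat (R : realType) (U : finType) (z : {ffun U -> R})
    (c : lincon R U) : bool :=
  match c with
  | LinLe a b => \sum_u a u * z u <= b
  | LinEq a b => \sum_u a u * z u == b
  end.

(* A finite linear system in the variables [vars F], a subset of the ambient
   set U of names. *)
Record linsys (R : realType) (U : finType) : Type := LinSys {
  vars : {set U};
  constrs : seq (lincon R U) }.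

(* The entries of z outside [vars F] are unconstrained when F is well formed. *)
Definition wf_linsys (R : realType) (U : finType) (F : linsys R U) : bool :=
  all (fun c => supp c \subset vars F) (constrs F).

Definition solutions (R : realType) (U : finType) (F : linsys R U) :
    set {ffun U -> R} :=
  [set z | all (sat z) (constrs F)].

Definition coord_var (V A : finType) (H : shypergraph V) (i : coord H) :
    var V A :=
  match i with inl v => zn A v | inr s => ze A (val s) end.

Definition proj (R : realType) (V A : finType) (H : shypergraph V)
    (z : {ffun var V A -> R}) : {ffun coord H -> R} :=
  [ffun i => z (coord_var A i)].

(* Every variable of F that is not indexed by a node or a signed edge of H,
   including a name [ze A t] with t not in H, is an additional variable. *)
Definition ext_formulation (R : realType) (V A : finType) (H : shypergraph V)
    (F : linsys R (var V A)) : Prop :=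
  [/\ wf_linsys F,
      forall i : coord H, coord_var A i \in vars F
    & @proj R V A H @` solutions F = @pb_polytope R V H].

Definition juxtapose (R : realType) (U : finType) (F : linsys R U)
    (c : lincon R U) : linsys R U :=
  LinSys (vars F :|: supp c)%SET (rcons (constrs F) c).

(* z_s - \sum_(s' in I(s,e)) z_s' = 0 *)
Definition inflation_eq (R : realType) (V A : finType) (s : sedge V)
    (e : {set V}) : lincon R (var V A) :=
  LinEq [ffun u => (u == ze A s)%:R
                   - \sum_(s' in inflations s e) (u == ze A s')%:R] 0.

(* Real polynomial functions of the numbers of nodes and signed edges;
   {poly {poly R}} is R[X][Y]. *)
Definition size_poly_eval (R : realType) (p : {poly {poly R}}) (V : finType)
    (H : shypergraph V) : R :=
  p.[(#|V|%:R)%:P].[#|H|%:R].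

(* The polynomial bound is uniform over the family indexed by I. *)
Definition poly_size_ext (R : realType) (I : Type) (V : I -> finType)
    (H : forall i, shypergraph (V i)) : Prop :=
  exists p : {poly {poly R}}, forall i,
    exists (A : finType) (F : linsys R (var (V i) A)),
      [/\ ext_formulation (H i) F,
          #|vars F|%:R <= size_poly_eval p (H i)
        & (size (constrs F))%:R <= size_poly_eval p (H i)].

(* f i = O(log poly(|V i|, |H i|)), with one polynomial and one constant for
   the whole family.  The library's [ln] is 0 on nonpositive arguments. *)
Definition O_log_poly (R : realType) (I : Type) (V : I -> finType)
    (H : forall i, shypergraph (V i)) (f : I -> nat) : Prop :=
  exists (g : {poly {poly R}}) (C : R), 0 < C /\
    forall i, (f i)%:R <= C * ln (size_poly_eval g (H i)).

(* Main.v *)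
Require Import Defs.
From HB Require Import structures.
From mathcomp Require Import all_boot all_order all_algebra.
From mathcomp Require Import classical_sets reals sequences exp.
Set Implicit Arguments.
Unset Strict Implicit.
Unset Printing Implicit Defensive.
Import Order.TTheory GRing.Theory Num.Theory.
Local Open Scope classical_set_scope.
Local Open Scope ring_scope.

(** The identity behind both claims is
    [prod_(v in s) sigma_s(z_v)
       = sum_(s' in I(s,e)) prod_(v in e) sigma_s'(z_v)]:
    multiply the left-hand side by [1 = prod_(v in e \ s) (z_v + (1 - z_v))] and
    expand.  The terms of the expansion are indexed by the extensions of the
    signs of [s] to [e], that is, by the inflations ([sum_inflations_prod]).

    A point of the pseudo-Boolean set is determined by its binary node values,
    so a point of the polytope of any hypergraph on [V] is the restriction, to
    the coordinates of that hypergraph, of a vector [mu] indexed by all nodes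
    and all signed edges on [V]: a convex combination of the evaluations of all
    monomials at binary points ([pb_polytopeP]).  By linearity such a [mu]
    satisfies [mu_s = sum_(s' in I(s,e)) mu_s'] ([moments_inflation]).  Hence,
    once the remaining coordinates are restrictions of a common [mu], adding
    the equation forces exactly [z_s = mu_s]; and conversely, as [z_s] does not
    occur in the given formulation, a lift of a point to the solutions of that
    formulation may be given the value [mu_s] at [z_s] ([juxtapose_ext]).

    For the size bound, a formulation for the inflated hypergraph may happen to
    use the name [z_s] for one of its additional variables; this variable is
    first renamed to a fresh name ([rename_free_name_ext]).  Juxtaposition then
    adds one variable and one constraint.  The inflated hypergraph has at most
    [|S| + 2 ^ (|e| - |s|)] signed edges ([card_inflate]), and the logarithmic
    hypothesis bounds the power of two by a power of a polynomial
    ([exp2_le_of_ln]).  The given size polynomial need not be monotone, so it is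
    majorized before this bound is substituted for its second argument
    ([poly2_majorant]). *)

(** * Summing over inflations *)

Lemma mem_dom (V : finType) (f : {ffun V -> option bool}) (v : V) :
  (v \in dom f) = (f v != None).
Proof. by rewrite inE. Qed.

Definition inflation_choices (V : finType) (s : sedge V) (v : V) :
    pred (option bool) :=
  fun b => if v \in dom s then b == s v else b != None.

(** The inflations of [s] to [e] form a dependent product of sets of signs over
    [e]; this is the form in which a product of sums over [e] expands. *)
Lemma inflations_pfamily (V : finType) (s : sedge V) (e : {set V}) :
  dom s \subset e ->
  [set sgn s' | s' in inflations s e]%SET
    =i pfamily None (mem e) (inflation_choices s).
Proof.
move=> sub f; apply/imsetP/pfamilyP => [[s' + ->]|[/fintype.subsetP supf fP]].
  rewrite inE => /andP[/eqP <- /forall_inP eq_s]; split=> [|v].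
    by apply/fintype.subsetP => v; rewrite !inE.
  rewrite -[v \in mem _]/(v \in dom s') mem_dom => s'v.
  rewrite unfold_in /inflation_choices.
  by case: ifP => // sv; exact: eq_s.
have dom_f : dom f = e.
  apply/finset.setP => v; apply/idP/idP => [|ve].
    by rewrite mem_dom => /supf.
  rewrite mem_dom; have := fP v ve; rewrite unfold_in /inflation_choices.
  by case: ifP => // + /eqP ->; rewrite mem_dom.
have card_f : (2 <= #|dom f|)%N.
  by rewrite dom_f (leq_trans _ (subset_leq_card sub)) //; case: (s).
exists (SEdge card_f) => //; rewrite inE /= dom_f eqxx /=.
apply/forall_inP => v sv; have := fP v (fintype.subsetP sub v sv).
by rewrite unfold_in /inflation_choices sv.
Qed.

(** Distributivity: a node of [s] has a single admissible sign, a node of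
    [e :\: dom s] has both.  Semirings are allowed so that the same expansion
    counts the inflations, over [nat]. *)
Lemma sum_inflations_prod (K : comNzSemiRingType) (V : finType) (s : sedge V)
    (e : {set V}) (F : V -> option bool -> K) :
  dom s \subset e ->
  \sum_(s' in inflations s e) \prod_(v in e) F v (s' v) =
  \prod_(v in dom s) F v (s v) *
  \prod_(v in e :\: dom s) (F v (Some true) + F v (Some false)).
Proof.
move=> sub.
transitivity
  (\sum_(f in [set sgn s' | s' in inflations s e]%SET) \prod_(v in e) F v (f v)).
  by rewrite big_imset //= => s1 s2 _ _ /val_inj.
rewrite (eq_bigl _ _ (inflations_pfamily sub)).
rewrite -(big_distr_big_dep None (mem e) (inflation_choices s)).
rewrite (big_setID (dom s)) /= (finset.setIidPr sub); congr (_ * _).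
  apply: eq_bigr => v sv; rewrite (eq_bigl (pred1 (s v))) ?big_pred1_eq //.
  by move=> b; rewrite /inflation_choices sv.
apply: eq_bigr => v; rewrite inE => /andP[/negbTE sv _].
rewrite (bigD1 (Some true)) /=; last by rewrite /inflation_choices sv.
congr (_ + _); rewrite (eq_bigl (pred1 (Some false))) ?big_pred1_eq //.
by move=> b; rewrite /inflation_choices sv; case: b => [[]|].
Qed.

Lemma card_inflations (V : finType) (s : sedge V) (e : {set V}) :
  dom s \subset e -> #|inflations s e| = (2 ^ (#|e| - #|dom s|))%N.
Proof.
move=> sub.
have := @sum_inflations_prod nat _ _ _ (fun _ _ => 1%N) sub.
rewrite (eq_bigr (fun _ => 1%N)); last by move=> ? _; exact: big1_eq.
rewrite big1_eq mul1r prodr_const cardsD (finset.setIidPr sub) => sumE.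
rewrite -sum1_card; apply: etrans sumE _.
by rewrite natrXE.
Qed.

Lemma inflations_neq (V : finType) (s : sedge V) (e : {set V}) :
  dom s \proper e -> s \notin inflations s e.
Proof. by move=> /proper_neq; rewrite inE => /negbTE ->. Qed.

Lemma inflations_sub (V : finType) (H : shypergraph V) (s : sedge V)
    (e : {set V}) :
  dom s \proper e -> inflations s e \subset inflate H s e.
Proof.
move=> pr; apply/fintype.subsetP => t tI.
rewrite finset.in_setD1 finset.in_setU tI orbT andbT.
by apply: contraNneq (inflations_neq pr) => ts; rewrite -{1}ts.
Qed.

(** * The polytope as a restriction of moment vectors *)

(** The value at [b] of every coordinate that any signed hypergraph on [V] may
    have, independently of which signed edges are present. *)
Definition pb_eval (R : realType) (V : finType) (b : V -> R)
    (i : V + sedge V) : R :=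
  match i with
  | inl v => b v
  | inr t => \prod_(v in dom t) sigma t v (b v)
  end.

(** The pseudo-Boolean polytope of the hypergraph of all signed edges on [V].
    Stated with the binary points themselves, so that restricting to the
    coordinates of a hypergraph needs no dependent types. *)
Definition moments (R : realType) (V : finType) (mu : V + sedge V -> R) :
    Prop :=
  exists (n : nat) (b : 'I_n -> V -> R) (l : 'I_n -> R),
    [/\ forall k v, b k v = 0 \/ b k v = 1, forall k, 0 <= l k, \sum_k l k = 1
      & forall i, mu i = \sum_k l k * pb_eval (b k) i].

(* The unqualified name [coord] would denote the coordinates of a vector in a
   basis. *)
Definition forget (V : finType) (H : shypergraph V) (i : Defs.coord H) :
    V + sedge V :=
  match i with inl v => inl v | inr t => inr (val t) end.

Lemma pb_eval_binary (R : realType) (V : finType) (b : V -> R)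
    (i : V + sedge V) :
  (forall v, b v = 0 \/ b v = 1) -> pb_eval b i = 0 \/ pb_eval b i = 1.
Proof.
move=> bin; case: i => [v|t] //=.
apply: (big_ind (fun x : R => x = 0 \/ x = 1)) => [|x y|v _]; first by right.
  by case=> ->; rewrite ?mul0r ?mul1r; [left|].
by rewrite /sigma; case: ifP; case: (bin v) => ->; rewrite ?subrr ?subr0;
  [right|left|left|right].
Qed.

(** All the polytopes on [V] are coordinate projections of a single one, since
    an edge coordinate of a vertex is a function of its node coordinates.
    Passing between a hypergraph and its inflation is then a mere change of the
    coordinates that are read off [mu]. *)
Lemma pb_polytopeP (R : realType) (V : finType) (H : shypergraph V)
    (x : {ffun Defs.coord H -> R}) :
  @pb_polytope R V H x <->
  exists mu : V + sedge V -> R, moments mu /\ forall i, x i = mu (forget i).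
Proof.
split=> [[n [p [l [pS l0 l1 ->]]]]|[mu [[n [b [l [bin l0 l1 muE]]]] xE]]].
  pose b k v := p k (inl v).
  exists (fun i => \sum_k l k * pb_eval (b k) i); split.
    by exists n, b, l; split=> // k v; case: (pS k) => /(_ (inl v)).
  move=> i; rewrite ffunE; apply: eq_bigr => k _; congr (_ * _).
  by case: i => [//|t]; case: (pS k) => _ ->.
exists n, (fun k => [ffun i => pb_eval (b k) (forget i)]), l; split=> //.
  move=> k; split=> [i|t]; rewrite !ffunE; first exact/pb_eval_binary/bin.
  by apply: eq_bigr => v _; rewrite ffunE.
by apply/ffunP => i; rewrite xE muE ffunE; apply: eq_bigr => k _; rewrite ffunE.
Qed.

(** The polynomial identity holds at each binary point, and it is linear in the
    monomials, so it passes to convex combinations. *)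
Lemma moments_inflation (R : realType) (V : finType) (mu : V + sedge V -> R)
    (s : sedge V) (e : {set V}) :
  moments mu -> dom s \subset e ->
  mu (inr s) = \sum_(s' in inflations s e) mu (inr s').
Proof.
move=> [n [b [l [_ _ _ muE]]]] sub; under [RHS]eq_bigr do rewrite muE.
rewrite muE exchange_big; apply: eq_bigr => k _; rewrite -mulr_sumr.
congr (_ * _); rewrite /=.
pose F v (a : option bool) := if a == Some false then 1 - b k v else b k v.
transitivity (\sum_(s' in inflations s e) \prod_(v in e) F v (s' v)).
  rewrite sum_inflations_prod // [X in _ * X]big1 ?mulr1 // => v _.
  by rewrite /F /= addrC subrK.
by apply: eq_bigr => s'; rewrite inE => /andP[/eqP <- _].
Qed.

(** * Linear systems *)

Lemma eq_sat (R : realType) (U : finType) (c : lincon R U)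
    (z z' : {ffun U -> R}) :
  {in supp c, z =1 z'} -> sat z c = sat z' c.
Proof.
move=> eqz.
have eqs : \sum_u coef c u * z u = \sum_u coef c u * z' u.
  apply: eq_bigr => u _; have [->|cu] := eqVneq (coef c u) 0.
    by rewrite !mul0r.
  by rewrite eqz // inE.
by case: c eqz eqs => a b _ /= ->.
Qed.

Lemma eq_solutions (R : realType) (U : finType) (F : linsys R U)
    (z z' : {ffun U -> R}) :
  wf_linsys F -> {in vars F, z =1 z'} -> solutions F z -> solutions F z'.
Proof.
rewrite /wf_linsys /solutions /= => wf eqz sol.
have /= := conj wf sol; move/andP; rewrite -all_predI.
apply: sub_all => c /andP[/= cF]; rewrite (@eq_sat _ _ _ z z') // => u uc.
exact: eqz (fintype.subsetP cF u uc).
Qed.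

Lemma sat_inflation_eq (R : realType) (V A : finType) (s : sedge V)
    (e : {set V}) (z : {ffun var V A -> R}) :
  sat z (inflation_eq R A s e) =
  (z (ze A s) == \sum_(s' in inflations s e) z (ze A s')).
Proof.
rewrite /= -[RHS]subr_eq0; congr (_ == _).
have pick_u (w : var V A) : \sum_u (u == w)%:R * z u = z w.
  rewrite (bigD1 w) //= eqxx mul1r big1 ?addr0 // => u /negbTE ->.
  by rewrite mul0r.
under eq_bigr do rewrite ffunE mulrBl mulr_suml.
rewrite sumrB pick_u exchange_big; congr (_ - _).
by apply: eq_bigr => s' _; rewrite pick_u.
Qed.

Lemma supp_inflation_eq (R : realType) (V A : finType) (s : sedge V)
    (e : {set V}) :
  supp (inflation_eq R A s e)
    \subset ze A s |: [set ze A s' | s' in inflations s e]%SET.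
Proof.
apply/fintype.subsetP => u; rewrite finset.in_setU1 finset.in_set ffunE.
case: (u == ze A s) => //=.
rewrite sub0r oppr_eq0; apply: contraNT => /imsetP uI.
rewrite big1 // => s' s'I; case: eqP => // us'.
by case: uI; exists s'.
Qed.

Lemma ze_supp_inflation_eq (R : realType) (V A : finType) (s : sedge V)
    (e : {set V}) :
  dom s \proper e -> ze A s \in supp (inflation_eq R A s e).
Proof.
move=> pr; rewrite inE ffunE eqxx big1 ?subr0 ?oner_eq0 // => s' s'I.
by case: eqP => // -[ss']; move: s'I (inflations_neq pr); rewrite -ss' => ->.
Qed.

Lemma ext_inflations_vars (R : realType) (V A : finType) (H : shypergraph V)
    (s : sedge V) (e : {set V}) (F : linsys R (var V A)) :
  dom s \proper e -> ext_formulation (inflate H s e) F ->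
  [set ze A s' | s' in inflations s e]%SET \subset vars F.
Proof.
move=> pr [_ cF _]; apply/fintype.subsetP => _ /imsetP[s' s'I ->].
exact: cF (inr (Sub s' (fintype.subsetP (inflations_sub H pr) s' s'I))).
Qed.

(** Both inclusions transport one moment vector between the two hypergraphs:
    every signed edge of [H] other than [s] is an edge of the inflation, and
    [z_s] is read off the inflations of [s]. *)
Lemma juxtapose_ext (R : realType) (V A : finType) (H : shypergraph V)
    (s : sedge V) (e : {set V}) (F : linsys R (var V A)) :
  dom s \proper e -> ext_formulation (inflate H s e) F ->
  ze A s \notin vars F ->
  ext_formulation H (juxtapose F (inflation_eq R A s e)).
Proof.
move=> pr extF sF; have [wfF cF projF] := extF.
have sub := proper_sub pr.
have inH' t : t \in H -> t != s -> t \in inflate H s e.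
  by move=> tH ts; rewrite finset.in_setD1 finset.in_setU ts tH.
have IH' s' : s' \in inflations s e -> s' \in inflate H s e.
  exact: (fintype.subsetP (inflations_sub H pr)).
split.
- rewrite /wf_linsys all_rcons /= finset.subsetUr /=.
  by apply: sub_all wfF => c /fintype.subset_trans; apply;
    exact: finset.subsetUl.
- move=> [v|[t tH]]; rewrite /= inE; first by rewrite (cF (inl v)).
  have [->|ts] := eqVneq t s; first by rewrite ze_supp_inflation_eq // orbT.
  by rewrite (cF (inr (Sub t (inH' t tH ts)))).
apply/seteqP; split=> [_ [z + <-]|x /pb_polytopeP [mu [muM xE]]].
- rewrite /solutions /= all_rcons sat_inflation_eq => /andP[/eqP zs solF].
  have : @pb_polytope R V (inflate H s e) (@proj R V A (inflate H s e) z).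
    by rewrite -projF; exists z.
  move=> /pb_polytopeP[mu [muM zE]]; apply/pb_polytopeP; exists mu; split=> //.
  have zE' t : t \in inflate H s e -> z (ze A t) = mu (inr t).
    by move=> tH'; have := zE (inr (Sub t tH')); rewrite ffunE.
  move=> [v|[t tH]]; rewrite ffunE /=.
    by have := zE (inl v); rewrite ffunE.
  have [->|ts] := eqVneq t s; last exact/zE'/inH'.
  rewrite zs (moments_inflation muM sub).
  by apply: eq_bigr => s' /IH' /zE'.
- have : @pb_polytope R V (inflate H s e) [ffun i => mu (forget i)].
    by apply/pb_polytopeP; exists mu; split=> // i; rewrite ffunE.
  rewrite -projF => -[z solz /ffunP zE].
  (* [z] is arbitrary at the name of [s], which the system [F] does not use. *)
  pose z' := [ffun u => if u == ze A s then mu (inr s) else z u].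
  have z'E t : t \in inflate H s e -> z' (ze A t) = mu (inr t).
    move=> tH'; have := zE (inr (Sub t tH')); rewrite !ffunE /= => <-.
    case: eqP => // -[ts]; move: tH'.
    by rewrite ts finset.in_setD1 eqxx.
  have z's : z' (ze A s) = mu (inr s) by rewrite ffunE eqxx.
  exists z'.
    rewrite /solutions /= all_rcons sat_inflation_eq; apply/andP; split.
      rewrite z's (moments_inflation muM sub); apply/eqP/eq_bigr.
      by move=> s' /IH' /z'E.
    apply: eq_solutions wfF _ solz => u uF; rewrite ffunE.
    by case: eqP => // us; rewrite us (negbTE sF) in uF.
  apply/ffunP => -[v|[t tH]]; rewrite ffunE xE /=.
    by have := zE (inl v); rewrite !ffunE.
  have [->|ts] := eqVneq t s; [exact: z's|exact/z'E/inH'].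
Qed.

(** * Renaming variables *)

(** Transport of coefficients along a renaming: [push rho a] has the same value
    on [z] as [a] has on [z \o rho], even when [rho] identifies names. *)
Definition push (R : realType) (U W : finType) (rho : U -> W)
    (a : {ffun U -> R}) : {ffun W -> R} :=
  [ffun w => \sum_(u | rho u == w) a u].

Definition rename_con (R : realType) (U W : finType) (rho : U -> W)
    (c : lincon R U) : lincon R W :=
  match c with
  | LinLe a b => LinLe (push rho a) b
  | LinEq a b => LinEq (push rho a) b
  end.

Definition rename (R : realType) (U W : finType) (rho : U -> W)
    (F : linsys R U) : linsys R W :=
  LinSys (rho @: vars F)%SET (map (rename_con rho) (constrs F)).

Lemma push_inj (R : realType) (U W : finType) (rho : U -> W)
    (a : {ffun U -> R}) (u : U) :
  injective rho -> push rho a (rho u) = a u.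
Proof.
by move=> inj; rewrite ffunE (eq_bigl (pred1 u)) ?big_pred1_eq // => w;
  rewrite inE (inj_eq inj).
Qed.

Lemma sat_rename (R : realType) (U W : finType) (rho : U -> W)
    (c : lincon R U) (z : {ffun W -> R}) :
  sat z (rename_con rho c) = sat [ffun u => z (rho u)] c.
Proof.
have sumE (a : {ffun U -> R}) :
    \sum_w push rho a w * z w = \sum_u a u * [ffun u => z (rho u)] u.
  rewrite [RHS](partition_big rho xpredT) //=; apply: eq_bigr => w _.
  rewrite ffunE mulr_suml; apply: eq_bigr => u /eqP <-.
  by rewrite ffunE.
by case: c => a b /=; rewrite sumE.
Qed.

Lemma supp_rename (R : realType) (U W : finType) (rho : U -> W)
    (c : lincon R U) :
  supp (rename_con rho c) \subset (rho @: supp c)%SET.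
Proof.
have -> : supp (rename_con rho c) = [set w | push rho (coef c) w != 0]%SET.
  by case: c.
apply/fintype.subsetP => w; rewrite inE ffunE; apply: contraNT => wc.
rewrite big1 // => u /eqP uw; apply/eqP; apply: contraNT wc => cu.
by rewrite -uw finset.imset_f // inE.
Qed.

(** Solutions correspond in both directions: a solution of the renamed system is
    pulled back by composition with [rho], and a solution of the original one is
    extended by zero to the names that [rho] misses, via [push]. *)
Lemma rename_ext (R : realType) (V A B : finType) (H : shypergraph V)
    (rho : var V A -> var V B) (F : linsys R (var V A)) :
  injective rho ->
  (forall i : Defs.coord H, rho (coord_var A i) = coord_var B i) ->
  ext_formulation H F -> ext_formulation H (rename rho F).
Proof.
move=> inj rhoE [wfF cF projF]; split.
- rewrite /wf_linsys all_map; apply: sub_all wfF => c cc /=.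
  exact: fintype.subset_trans (supp_rename _ _) (finset.imsetS _ cc).
- by move=> i; rewrite -rhoE finset.imset_f.
rewrite -projF; apply/seteqP; split=> _ [z solz <-].
  exists [ffun u => z (rho u)].
    move: solz; rewrite /solutions /= all_map.
    by apply: sub_all => c /=; rewrite sat_rename.
  by apply/ffunP => i; rewrite !ffunE rhoE.
exists (push rho z).
  move: solz; rewrite /solutions /= all_map; apply: sub_all => c /=.
  rewrite sat_rename; congr (is_true (sat _ c)).
  by apply/ffunP => u; rewrite ffunE push_inj.
by apply/ffunP => i; rewrite [LHS]ffunE -rhoE push_inj // ffunE.
Qed.

(** Frees the name [z_s]; the anonymous name [None] takes over its role. *)
Definition free_name (V A : finType) (s : sedge V) (u : var V A) :
    var V (option A) :=
  match u with
  | inl (inl v) => zn _ v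
  | inl (inr t) => if t == s then inr None else ze _ t
  | inr a => inr (Some a)
  end.

Lemma free_name_inj (V A : finType) (s : sedge V) :
  injective (@free_name V A s).
Proof.
move=> [[v|t]|a] [[v'|t']|a'] //=; do ?[by case: ifP]; try by case=> ->.
by case: eqP => [->|_]; case: eqP => [->|_] // -[->].
Qed.

Lemma free_nameP (V A : finType) (s : sedge V) (u : var V A) :
  free_name s u != ze _ s.
Proof.
case: u => [[v|t]|a] //=; have [//|ts] := eqVneq t s.
by apply: contra_neq ts => -[].
Qed.

Lemma rename_free_name_ext (R : realType) (V A : finType) (H : shypergraph V)
    (s : sedge V) (F : linsys R (var V A)) :
  s \notin H -> ext_formulation H F ->
  ext_formulation H (rename (free_name s) F).
Proof.
move=> sH; apply: rename_ext; first exact: free_name_inj.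
move=> [v|[t tH]] //=; case: eqP => // ts.
by rewrite -ts tH in sH.
Qed.

(** * Polynomial bounds *)

(** Taking absolute values of the coefficients makes a polynomial monotone on
    nonnegative arguments, so an upper bound [r] for the argument can be
    substituted.  The recursion is Horner's, with [r] already in place of the
    variable. *)
Lemma poly_majorant (R : realType) (p : {poly R}) (r : {poly {poly R}}) :
  exists q : {poly {poly R}}, forall x y t : R,
    0 <= y <= r.[x%:P].[t] -> `|p.[y]| <= q.[x%:P].[t].
Proof.
elim/poly_ind: p => [|p a [q qP]].
  by exists 0 => *; rewrite !horner0 normr0.
exists (q * r + `|a|%:P%:P) => x y t /[dup] /qP pq /andP[y0 yr].
rewrite !hornerE (le_trans (ler_normD _ _)) // lerD2r normrM (ger0_norm y0).
exact: ler_pM.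
Qed.

(** The bivariate version: only the second argument, which stands for the
    number of signed edges, is replaced by its bound [r]. *)
Lemma poly2_majorant (R : realType) (p r : {poly {poly R}}) :
  exists q : {poly {poly R}}, forall x y t : R,
    0 <= x -> 0 <= y <= r.[x%:P].[t] -> `|p.[x%:P].[y]| <= q.[x%:P].[t].
Proof.
elim/poly_ind: p => [|p a [q qP]].
  by exists 0 => *; rewrite !horner0 normr0.
have [q' q'P] := poly_majorant a r.
exists (q * 'X + q') => x y t x0 yr.
rewrite !hornerE (le_trans (ler_normD _ _)) // lerD ?q'P //.
by rewrite normrM (ger0_norm x0) ler_wpM2r ?qP.
Qed.

(** [2 ^ d <= exp d <= exp (C ln G) <= G ^ k] for any natural [k >= C].  The
    case [d = 0] is excluded because [d > 0] is what forces [ln G > 0], hence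
    [G > 1]. *)
Lemma exp2_le_of_ln (R : realType) (C G : R) (d : nat) :
  (0 < d)%N -> 0 < C -> d%:R <= C * ln G ->
  2 ^+ d <= G ^+ Num.bound C.
Proof.
move=> d0 C0 dG.
have lnG : 0 < ln G by rewrite -(pmulr_rgt0 _ C0) (lt_le_trans _ dG) ?ltr0n.
have G0 : 0 < G.
  by rewrite ltNge; apply/negP => /ln0 G0; rewrite G0 ltxx in lnG.
rewrite -[G in leRHS]lnK ?posrE // -expRM_natl.
apply: (@le_trans _ _ (expR d%:R)).
  rewrite -[d%:R]mulr1 expRM_natl ler_pXn2r ?nnegrE ?expR_ge0 //.
  exact: expR_ge1Dx.
rewrite ler_expR (le_trans dG) // ler_pM2r //.
exact/ltW/archi_boundP/ltW.
Qed.

Lemma card_inflate (V : finType) (H : shypergraph V) (s : sedge V)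
    (e : {set V}) :
  dom s \subset e -> (#|inflate H s e| <= #|H| + 2 ^ (#|e| - #|dom s|))%N.
Proof.
move=> sub; rewrite -card_inflations //.
apply: leq_trans (subset_leq_card (finset.subsetDl _ _)) _.
by rewrite cardsU leq_subr.
Qed.

(** Only [z_s] can be new: the inflations of [s] are edges of the inflated
    hypergraph, so their variables occur in [F] already. *)
Lemma card_vars_juxtapose (R : realType) (V A : finType) (H : shypergraph V)
    (s : sedge V) (e : {set V}) (F : linsys R (var V A)) :
  dom s \proper e -> ext_formulation (inflate H s e) F ->
  (#|vars (juxtapose F (inflation_eq R A s e))| <= #|vars F|.+1)%N.
Proof.
move=> pr extF; rewrite -add1n.
apply: (@leq_trans #|ze A s |: vars F|); last first.
  by rewrite cardsU1 leq_add2r leq_b1.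
apply/subset_leq_card; rewrite finset.subUset finset.subsetUr.
apply: fintype.subset_trans (supp_inflation_eq R A s e) _.
exact/finset.setUS/(ext_inflations_vars pr extF).
Qed.

Lemma poly_size_ext_inflate (R : realType) (I : Type) (V : I -> finType)
    (H : forall i, shypergraph (V i)) (s : forall i, sedge (V i))
    (e : forall i, {set V i}) :
  (forall i, dom (s i) \proper e i) ->
  poly_size_ext R (fun i => inflate (H i) (s i) (e i)) ->
  O_log_poly R H (fun i => (#|e i| - #|dom (s i)|)%N) ->
  poly_size_ext R H.
Proof.
move=> pr [p pP] [g [C [C0 gP]]].
(* The substituted bound is [|S| + g ^ k], since [2 ^ (|e| - |s|) <= g ^ k]. *)
have [q qP] := poly2_majorant p ('X%:P + g ^+ Num.bound C).
(* The summand 1 is for the added variable and the added constraint. *)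
exists (q + 1) => i; have [A [F [extF varsF consF]]] := pP i.
have pq : size_poly_eval p (inflate (H i) (s i) (e i)) + 1
    <= size_poly_eval (q + 1) (H i).
  rewrite /size_poly_eval !hornerE lerD2r (le_trans (ler_norm _)) //.
  apply: qP => //; rewrite ler0n !hornerE.
  apply: le_trans (_ : (#|H i| + 2 ^ (#|e i| - #|dom (s i)|))%:R <= _).
    by rewrite ler_nat card_inflate ?proper_sub.
  rewrite natrD natrX lerD2l.
  by rewrite exp2_le_of_ln // subn_gt0 proper_card.
have sH' : s i \notin inflate (H i) (s i) (e i) by rewrite finset.in_setD1 eqxx.
have extF' := rename_free_name_ext sH' extF.
exists (option A), (juxtapose (rename (free_name (s i)) F)
                     (inflation_eq R _ (s i) (e i))); split.
- apply: juxtapose_ext (pr i) extF' _; apply/imsetP => -[u _ /esym/eqP].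
  by rewrite (negbTE (free_nameP _ _)).
- apply: le_trans pq; apply: le_trans (_ : #|vars F|.+1%:R <= _); last first.
    by rewrite -natr1 lerD2r.
  rewrite ler_nat (leq_trans (card_vars_juxtapose (pr i) extF')) //.
  by rewrite ltnS leq_imset_card.
- by apply: le_trans pq; rewrite size_rcons size_map -natr1 lerD2r.
Qed.

Theorem theorem3 (R : realType) :
  (forall (V : finType) (H : shypergraph V) (s : sedge V) (e : {set V}),
     s \in H -> dom s \proper e ->
     forall (A : finType) (F : linsys R (var V A)),
       ext_formulation (inflate H s e) F ->
       ze A s \notin vars F ->
       ext_formulation H (juxtapose F (inflation_eq R A s e)))
  /\
  (forall (I : Type) (V : I -> finType) (H : forall i, shypergraph (V i))
     (s : forall i, sedge (V i)) (e : forall i, {set V i}),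
     (forall i, s i \in H i) ->
     (forall i, dom (s i) \proper e i) ->
     poly_size_ext R (fun i => inflate (H i) (s i) (e i)) ->
     O_log_poly R H (fun i => (#|e i| - #|dom (s i)|)%N) ->
     poly_size_ext R H).
Proof.
split=> [V H s e _ pr A F|I V H s e _ pr]; first exact: juxtapose_ext.
exact: poly_size_ext_inflate.
Qed.
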